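(* Let $p,q$ be relatively prime integers, $p\neq0$. Then $L(p^2,q)$ has at most $|p|$ vanishing correction terms, i.e. there are at most $|p|$ elements $n\in\mathbb Z/p^2\mathbb Z$ with $d(L(p^2,q),n)=0$.
   Context: Heegaard Floer correction terms. For a rational homology $3$-sphere $Y$ with a spin$^{\mathbb C}$-structure $\mathfrak s$, $d(Y,\mathfrak s)\in\mathbb Q$ denotes the Heegaard Floer correction term of Ozsváth and Szabó. For relatively prime integers $m,q$ with $m>0$, the set of spin$^{\mathbb C}$-structures of the lens space $L(m,q)$ (oriented so that it is $m/q$-surgery on the unknot in $S^3$) is identified with $H^2(L(m,q);\mathbb Z)\cong\mathbb Z/m\mathbb Z$ by the Ozsváth–Szabó labelling, and one writes $d(L(m,q),n)$ for $n\in\mathbb Z/m\mathbb Z$. These numbers depend on $q$ and $n$ only modulo $m$ (since $L(m,q+km)\cong L(m,q)$ for $k\in\mathbb Z$), satisfy $d(L(1,1),0)=0$, and by a theorem of Ozsváth and Szabó satisfy, for all relatively prime $0<q<m$ and $0\le n<m+q$, $$d(L(m,q),n)+d(L(q,m),n)=\frac14+\frac{n^2}{mq}+n\left(\frac1{mq}-\frac1q-\frac1m\right)+\frac14\left(\frac mq+\frac1{mq}+\frac qm\right)-\frac1{2q}-\frac1{2m}.$$ These properties determine all $d(L(m,q),n)$ for relatively prime $m>0$ and $q$. *)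

(* Defs.v *)
From HB Require Import structures.
From mathcomp Require Import all_boot all_order all_algebra.
From mathcomp Require Import zify ring lra.

Set Implicit Arguments.
Unset Strict Implicit.
Unset Printing Implicit Defensive.

Import Order.TTheory GRing.Theory Num.Theory.
Local Open Scope ring_scope.

Definition reciprocity_rhs (m q n : int) : rat :=
  let m' := m%:~R in let q' := q%:~R in let n' := n%:~R in
  1 / 4 + n' ^+ 2 / (m' * q') + n' * (1 / (m' * q') - 1 / q' - 1 / m')
  + 1 / 4 * (m' / q' + 1 / (m' * q') + q' / m') - 1 / (2 * q') - 1 / (2 * m').

(* Heegaard Floer homology is not available, so the correction terms of lens
   spaces enter through the properties that determine them: [d m q n] stands
   for d(L(m,q), n), where the integer n represents a class in Z/mZ.  Nothing
   is required of [d m q n] unless m > 0 and m, q are coprime.  That these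
   properties can be satisfied, and in only one way, is proved below in
   [lens_correction_terms_exist] and [lens_correction_terms_unique]. *)
Record lens_correction_terms (d : int -> int -> int -> rat) : Prop := {
  lens_d_modq : forall m q n k : int, 0 < m -> coprimez m q ->
    d m (q + k * m) n = d m q n;
  lens_d_modn : forall m q n k : int, 0 < m -> coprimez m q ->
    d m q (n + k * m) = d m q n;
  lens_d_sphere : d 1 1 0 = 0;
  lens_d_reciprocity : forall m q n : int, 0 < q -> q < m -> coprimez m q ->
    0 <= n -> n < m + q ->
    d m q n + d q m n = reciprocity_rhs m q n
}.

Lemma lens_d1 d q n : lens_correction_terms d -> d 1 q n = 0.
Proof.
move=> hd.
have c1 (x : int) : coprimez 1 x by rewrite /coprimez gcd1z.
have := lens_d_modn hd (q := q) 0 n ltr01 (c1 _).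
rewrite mulr1 add0r => ->.
have := lens_d_modq hd (q := 1) 0 (q - 1) ltr01 (c1 _).
by rewrite mulr1 addrC subrK => ->; rewrite (lens_d_sphere hd).
Qed.

Lemma lens_d_mod d m q n : lens_correction_terms d -> 0 < m -> coprimez m q ->
  d m q n = d m (q %% m)%Z (n %% m)%Z.
Proof.
move=> hd m0 mq.
rewrite [in LHS](divz_eq n m) addrC (lens_d_modn hd) //.
rewrite [in LHS](divz_eq q m) addrC (lens_d_modq hd) //.
by rewrite /coprimez gcdz_modr.
Qed.

Lemma coprimez_mod_gt0 (m q : int) :
  1 < m -> coprimez m q -> 0 < (q %% m)%Z < m.
Proof.
move=> m1 mq; rewrite ltz_pmod; last by lia.
rewrite andbT lt_neqAle modz_ge0 ?andbT; last by lia.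
apply/negP => /eqP q0; move: mq.
rewrite /coprimez -gcdz_modr -q0 gcdz0; lia.
Qed.

Lemma lens_correction_terms_unique (d1 d2 : int -> int -> int -> rat) :
  lens_correction_terms d1 -> lens_correction_terms d2 ->
  forall m q n : int, 0 < m -> coprimez m q -> d1 m q n = d2 m q n.
Proof.
move=> h1 h2 m.
have [k] := ubnP (absz m); elim: k m => // k IH m mk q n m0 mq.
have [->|m1] := eqVneq m 1; first by rewrite !lens_d1.
have {}m1 : 1 < m by lia.
rewrite (lens_d_mod n h1) // (lens_d_mod n h2) //.
have /andP[r0 rm] := coprimez_mod_gt0 m1 mq.
have mr : coprimez m (q %% m)%Z by rewrite /coprimez gcdz_modr.
have n0 : 0 <= (n %% m)%Z by rewrite modz_ge0 //; lia.
have nm : (n %% m)%Z < m by rewrite ltz_pmod.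
move: (q %% m)%Z (n %% m)%Z r0 rm mr n0 nm => r s r0 rm mr s0 sm.
have srm : s < m + r by lia.
have e1 := lens_d_reciprocity h1 r0 rm mr s0 srm.
have e2 := lens_d_reciprocity h2 r0 rm mr s0 srm.
have e : d1 r m s = d2 r m s.
  by apply: IH => //; [lia | rewrite coprimez_sym].
by apply: (addIr (d1 r m s)); rewrite e1 e e2.
Qed.

(* Euclid's algorithm with recursion depth at most k; k >= m is enough. *)
Fixpoint euclid_d (k : nat) (m q n : int) : rat :=
  if k is k'.+1 then
    if m == 1 then 0 else
    let r := (q %% m)%Z in let s := (n %% m)%Z in
    reciprocity_rhs m r s - euclid_d k' r m s
  else 0.

Lemma euclid_d_indep k l (m q n : int) : 0 < m -> coprimez m q ->
  (absz m <= k)%N -> (absz m <= l)%N -> euclid_d k m q n = euclid_d l m q n.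
Proof.
elim: k l m q n => [|k IH] [|l] m q n m0 mq mk ml //=; try lia.
case: eqVneq => // m1.
have {}m1 : 1 < m by lia.
have /andP[r0 rm] := coprimez_mod_gt0 m1 mq.
congr (_ - _); apply: IH => //; try lia.
by rewrite coprimez_sym /coprimez gcdz_modr.
Qed.

Definition lens_d (m q n : int) : rat := euclid_d (absz m) m q n.

Lemma lens_dE (m q n : int) : 1 < m -> coprimez m q ->
  lens_d m q n =
  reciprocity_rhs m (q %% m)%Z (n %% m)%Z - lens_d (q %% m)%Z m (n %% m)%Z.
Proof.
move=> m1 mq; rewrite /lens_d.
have -> : absz m = (absz m).-1.+1 by lia.
rewrite /= ifN; last by lia.
have /andP[r0 rm] := coprimez_mod_gt0 m1 mq.
congr (_ - _); apply: euclid_d_indep => //; try lia.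
by rewrite coprimez_sym /coprimez gcdz_modr.
Qed.

Lemma lens_d_period (m q q' n n' : int) : 0 < m -> coprimez m q ->
  (q = q' %[mod m])%Z -> (n = n' %[mod m])%Z -> lens_d m q n = lens_d m q' n'.
Proof.
move=> m0 mq eq en; have [->//|m1] := eqVneq m 1.
have {}m1 : 1 < m by lia.
have mq' : coprimez m q' by rewrite /coprimez -gcdz_modr -eq gcdz_modr.
by rewrite (lens_dE n m1 mq) (lens_dE n' m1 mq') eq en.
Qed.

Lemma reciprocity_rhs_diff (m q n : int) : 0 < m -> 0 < q ->
  reciprocity_rhs m q (n + m) - reciprocity_rhs m q n
  = (2 * n%:~R + 1 - q%:~R) / q%:~R.
Proof.
move=> m0 q0; rewrite /reciprocity_rhs intrD; field.
by rewrite !intr_eq0; apply/andP; split; lia.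
Qed.

Lemma reciprocity_rhsC (m q n : int) :
  reciprocity_rhs m q n = reciprocity_rhs q m n.
Proof. by rewrite /reciprocity_rhs (mulrC m%:~R q%:~R); ring. Qed.

Lemma lens_d_recip_small (m q n : int) : 0 < q -> q < m -> coprimez m q ->
  0 <= n -> n < m -> lens_d m q n + lens_d q m n = reciprocity_rhs m q n.
Proof.
move=> q0 qm mq n0 nm.
rewrite lens_dE ?(modz_small (m := q)) ?(modz_small (m := n)); try lia.
by rewrite subrK.
Qed.

Lemma lens_d_recip (m q n : int) : 0 < q -> q < m -> coprimez m q ->
  0 <= n -> n < m + q ->
  lens_d m q n + lens_d q m n = reciprocity_rhs m q n.
Proof.
have [k] := ubnP (absz m); elim: k m q n => // k IH m q n mk q0 qm mq n0 nmq.
have [nm|mn] := ltP n m; first exact: lens_d_recip_small.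
have [t nE] : {t : int | n = t + m} by exists (n - m); lia.
have t0 : 0 <= t by lia.
have tq : t < q by lia.
have qm' : coprimez q m by rewrite coprimez_sym.
have m0 : 0 < m by lia.
have E1 : lens_d m q n = lens_d m q t.
  by apply: lens_d_period => //; rewrite nE modzDr.
have E2 := lens_d_recip_small q0 qm mq t0 (lt_trans tq qm).
have E3 := reciprocity_rhs_diff t m0 q0.
suff E4 : lens_d q m n - lens_d q m t = (2 * t%:~R + 1 - q%:~R) / q%:~R.
  move: E3; rewrite -nE -E4 -E2 E1.
  move: (lens_d q m n) (lens_d q m t) (lens_d m q t) (reciprocity_rhs m q n).
  by clear=> a b c e h; lra.
have [q1|q1] := eqVneq q 1.
  have -> : t = 0 by lia.
  by rewrite q1 /lens_d /=; field.
have {}q1 : 1 < q by lia.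
have /andP[r0 rq] := coprimez_mod_gt0 q1 qm'.
pose r := (m %% q)%Z; rewrite -/r in r0 rq.
have qr : coprimez q r by rewrite /coprimez gcdz_modr.
have F1 : lens_d q m t = lens_d q r t.
  by apply: lens_d_period => //; rewrite modz_mod.
have F2 : lens_d q m n = lens_d q r (t + r).
  by apply: lens_d_period => //; rewrite ?modz_mod // nE modzDmr.
have F3 : lens_d r q (t + r) = lens_d r q t.
  by apply: lens_d_period; rewrite ?modzDr // coprimez_sym.
have G1 : lens_d q r t + lens_d r q t = reciprocity_rhs q r t.
  by apply: lens_d_recip_small.
have G2 : lens_d q r (t + r) + lens_d r q (t + r) = reciprocity_rhs q r (t + r).
  by apply: IH => //; lia.
have := reciprocity_rhs_diff t r0 q0.
rewrite 2!(reciprocity_rhsC r) -G1 -G2 F1 F2 F3 => <-.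
by rewrite opprD addrACA subrr addr0.
Qed.

Lemma lens_correction_terms_exist : lens_correction_terms lens_d.
Proof.
split.
- move=> m q n k m0 mq; apply: lens_d_period => //; last by rewrite addrC modzMDl.
  by rewrite /coprimez -gcdz_modr addrC modzMDl gcdz_modr.
- move=> m q n k m0 mq; apply: lens_d_period => //.
  by rewrite addrC modzMDl.
- by [].
- exact: lens_d_recip.
Qed.

(* Main.v *)
(* Comparing reciprocity at n and n + q gives
   d(L(m,q), n+q) - d(L(m,q), n) = (2n+1)/m modulo 1.  Since q generates Z/m,
   iterating this shows that if a and x both have vanishing correction term,
   then m divides (x - a)(x - (q - 1 - a)).  For m = p^2 such a split quadratic
   congruence has at most |p| solutions: by the Chinese remainder theorem it
   is enough to treat p = l^e with l prime.  If l^e divides the difference of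
   the two roots, all solutions agree modulo l^e; otherwise each solution is
   congruent to one of the roots modulo l^(e+1), which leaves at most
   2 l^(e-1) <= l^e of them. *)
Require Import Defs.
From mathcomp Require Import all_boot all_order all_algebra.
From mathcomp Require Import zify ring.

Import Order.TTheory GRing.Theory Num.Theory.
Local Open Scope ring_scope.

(** * Split quadratic congruences modulo a square *)

Lemma card_congruent_le (n k m : nat) (S : {set 'I_n}) : n = (k * m)%N ->
  {in S &, forall x y : 'I_n, (x = y %[mod k])%N} -> (#|S| <= m)%N.
Proof.
move=> nE hS.
have hlt (x : 'I_n) : (x %/ k < m)%N.
  have := ltn_ord x; rewrite [X in (_ < X)%N]nE => h.
  by rewrite ltn_divLR 1?mulnC //; case: (k) h.
(* All residues modulo [k] agree on [S], so the quotient by [k] determines an element. *)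
have inj : {in S &, injective (fun x : 'I_n => Ordinal (hlt x))}.
  move=> x y xS yS /(congr1 val) /= e; apply: val_inj => /=.
  by rewrite (divn_eq x k) (divn_eq y k) e (hS x y).
rewrite -(card_in_imset inj) -[X in (_ <= X)%N]card_ord.
exact: max_card.
Qed.

Lemma eqz_modn (k x y : nat) (a : int) :
  (k%:Z %| x%:Z - a)%Z -> (k%:Z %| y%:Z - a)%Z -> (x = y %[mod k])%N.
Proof.
move=> hx hy; have : (k%:Z %| x%:Z - y%:Z)%Z.
  have -> : x%:Z - y%:Z = (x%:Z - a) - (y%:Z - a) by lia.
  exact: rpredB.
by rewrite -eqz_mod_dvd !modz_nat => /eqP [].
Qed.

(** If [l ^ a.+1] does not divide [x], then [x] absorbs at most [a] of the [a + b] factors [l], and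
    the other [b] must divide [y]. *)
Lemma prime_pow_dvdz_mul (l a b : nat) (x y : int) : prime l ->
  ((l ^ (a + b))%N%:Z %| x * y)%Z ->
  ((l ^ a.+1)%N%:Z %| x)%Z \/ ((l ^ b)%N%:Z %| y)%Z.
Proof.
move=> pl; rewrite !dvdzE /= abszM.
move: `|x|%N `|y|%N => {}x {}y h.
have [|ndv] := boolP (l ^ a.+1 %| x)%N; [by left | right].
have x0 : (0 < x)%N by case: x ndv {h} => //; rewrite dvdn0.
have [u cu xE] := pfactor_coprime pl x0.
have la : (logn l x <= a)%N by move: ndv; rewrite pfactor_dvdn // -leqNgt.
have h2 : (l ^ b * l ^ logn l x %| (u * y) * l ^ logn l x)%N.
  rewrite mulnAC -xE; apply: dvdn_trans h; rewrite -expnD dvdn_exp2l //; lia.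
move: h2; rewrite dvdn_pmul2r ?expn_gt0 ?prime_gt0 // Gauss_dvdr //.
exact: coprimeXl.
Qed.

Definition split_roots (n : nat) (a b : int) : {set 'I_(n ^ 2)} :=
  [set x : 'I_(n ^ 2) | ((n ^ 2)%N%:Z %| (x%:Z - a) * (x%:Z - b))%Z].

Lemma card_split_roots_prime_pow (l e : nat) (a b : int) : prime l ->
  (#|split_roots (l ^ e) a b| <= l ^ e)%N.
Proof.
move=> pl; have l1 := prime_gt1 pl.
have Xe : ((l ^ e) ^ 2 = l ^ (e + e))%N by rewrite -expnM; congr expn; lia.
have dv (i j : nat) : (i <= j)%N -> ((l ^ i)%N%:Z %| (l ^ j)%N%:Z)%Z.
  by move=> ij; rewrite dvdzE /= dvdn_exp2l.
have [hab|hab] := boolP ((l ^ e)%N%:Z %| a - b)%Z.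
  apply: (@card_congruent_le _ (l ^ e)); first by rewrite mulnn.
  suff H (x : 'I__) : x \in split_roots (l ^ e) a b -> ((l ^ e)%N%:Z %| x%:Z - a)%Z.
    by move=> x y xS yS; apply: (@eqz_modn _ _ _ a); apply: H.
  rewrite inE [in X in (X %| _)%Z]Xe => h.
  case: e hab Xe x h => [|e] hab Xe x h; first exact: dvd1z.
  (* The exponent is split as [e + e.+2]; both alternatives put [x] in the class of [a] modulo
     [l ^ e.+1], because [b] lies in that class too. *)
  have := @prime_pow_dvdz_mul l e e.+2 _ _ pl; rewrite addnS -addSn => /(_ _ _ h).
  case=> // h2.
  have -> : x%:Z - a = (x%:Z - b) - (a - b) by lia.
  by rewrite rpredB //; apply: dvdz_trans h2; apply: dv.
case: e Xe hab => [|e] Xe hab; first by rewrite expn0 dvd1z in hab.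
(* One power of [l] beyond [l ^ e.+1] leaves at most [l ^ e] elements per root, and
   [2 * l ^ e <= l ^ e.+1]. *)
pose T c := [set x : 'I_((l ^ e.+1) ^ 2) | ((l ^ e.+2)%N%:Z %| x%:Z - c)%Z].
have cT c : (#|T c| <= l ^ e)%N.
  apply: (@card_congruent_le _ (l ^ e.+2)).
    by rewrite Xe -expnD; congr expn; lia.
  by move=> x y; rewrite !inE; apply: eqz_modn.
have sub : split_roots (l ^ e.+1) a b \subset T a :|: T b.
  apply/subsetP => x; rewrite !inE [in X in (X %| _)%Z]Xe => h.
  (* A root outside both sets would have [l ^ e.+1] dividing both factors, hence [a - b]. *)
  have [//|ha] := prime_pow_dvdz_mul l e.+1 e.+1 _ _ pl h; first by move->.
  have h' := h; rewrite mulrC in h'.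
  have [->|hb] := prime_pow_dvdz_mul l e.+1 e.+1 _ _ pl h'; first by rewrite orbT.
  case/negP: hab; have -> : a - b = (x%:Z - b) - (x%:Z - a) by lia.
  exact: rpredB.
apply: leq_trans (subset_leq_card sub) _.
apply: leq_trans (leq_card_setU _ _) _.
apply: leq_trans (leq_add (cT a) (cT b)) _.
by rewrite addnn -mul2n expnS leq_mul2r l1 orbT.
Qed.

(** Reduction modulo [m ^ 2] and [n ^ 2] sends roots to pairs of roots, injectively by the Chinese
    remainder theorem. *)
Lemma card_split_roots_mul (m n : nat) (a b : int) :
  (0 < m)%N -> (0 < n)%N -> coprime m n ->
  (#|split_roots (m * n) a b|
     <= #|split_roots m a b| * #|split_roots n a b|)%N.
Proof.
move=> m0 n0 cmn.
have m20 : (0 < m ^ 2)%N by rewrite expn_gt0 m0.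
have n20 : (0 < n ^ 2)%N by rewrite expn_gt0 n0.
have red (k : nat) (k0 : (0 < k ^ 2)%N) (x : nat) :
    (k ^ 2 %| (m * n) ^ 2)%N ->
    (((m * n) ^ 2)%N%:Z %| (x%:Z - a) * (x%:Z - b))%Z ->
    Ordinal (ltn_pmod x k0) \in split_roots k a b.
  move=> dk h; rewrite inE /=.
  have {h} h : ((k ^ 2)%N%:Z %| (x%:Z - a) * (x%:Z - b))%Z.
    by apply: dvdz_trans h; rewrite dvdzE.
  have : ((k ^ 2)%N%:Z %| x%:Z - (x %% k ^ 2)%N%:Z)%Z.
    by rewrite -eqz_mod_dvd !modz_nat modn_mod.
  move: (x %% k ^ 2)%N => r hr.
  have -> : (r%:Z - a) * (r%:Z - b) = (x%:Z - a) * (x%:Z - b)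
      - (x%:Z - r%:Z) * (x%:Z + r%:Z - a - b).
    by move: x%:Z r%:Z => u v; ring.
  by rewrite rpredB // dvdz_mulr.
pose f (x : 'I_((m * n) ^ 2)) :=
  (Ordinal (ltn_pmod x m20), Ordinal (ltn_pmod x n20)).
have inj : injective f.
  move=> x y [/= em en]; apply: val_inj => /=.
  have : (x == y %[mod m ^ 2 * n ^ 2])%N.
    by rewrite chinese_remainder ?coprimeXl ?coprimeXr // em en !eqxx.
  by rewrite -expnMn !modn_small // => /eqP.
rewrite -cardsX -(card_imset _ inj); apply/subset_leq_card/subsetP => _ /imsetP[x + ->].
rewrite inE => h; rewrite inE /=; apply/andP; split; apply: red => //.
  by rewrite expnMn dvdn_mulr.
by rewrite expnMn dvdn_mull.
Qed.

(** Strong induction: the full power of the least prime divisor of [n] is split off, leaving a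
    smaller coprime cofactor. *)
Lemma card_split_roots (n : nat) (a b : int) : (0 < n)%N ->
  (#|split_roots n a b| <= n)%N.
Proof.
have [k] := ubnP n; elim: k n => // k IH n nk n0.
have [n1|n1] := leqP n 1.
  have -> : n = 1%N by lia.
  by apply: leq_trans (max_card _) _; rewrite card_ord.
have pl := pdiv_prime n1; set l := pdiv n in pl.
have lgt : (1 < n`_l)%N.
  by rewrite p_part_gt1 mem_primes pl n0 pdiv_dvd.
have nE := partnC l n0.
have l'0 : (0 < n`_l^')%N by apply: part_gt0.
rewrite -nE; apply: leq_trans (card_split_roots_mul _ _ _ _ _ _ _) _ => //.
  exact: coprime_partC.
apply: leq_mul; first by rewrite p_part; apply: card_split_roots_prime_pow.
apply: IH => //; rewrite -ltnS (leq_trans _ nk) // ltnS -[X in (_ < X)%N]nE.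
by rewrite -[X in (X < _)%N]mul1n ltn_pmul2r.
Qed.

(** * The congruence relating two zeros *)

Section Zeros.
Variables (d : int -> int -> int -> rat) (hd : lens_correction_terms d).
Variables (m q : int).
Hypotheses (m1 : 1 < m) (mq : coprimez m q).

(* Modulo m, the correction terms of L(r,m) at n and n + r agree, so
   subtracting reciprocity at n from reciprocity at n + r eliminates them. *)
Lemma lens_d_addq (n : int) : exists k : int,
  d m q (n + q) - d m q n = (2 * n + 1)%:~R / m%:~R + k%:~R.
Proof.
have m0 : 0 < m by lia.
have /andP[r0 rm] := coprimez_mod_gt0 m1 mq.
have n0 : 0 <= (n %% m)%Z by rewrite modz_ge0 //; lia.
have nm : (n %% m)%Z < m by rewrite ltz_pmod.
have mr : coprimez m (q %% m)%Z by rewrite /coprimez gcdz_modr.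
have eq1 x : d m q x = d m (q %% m)%Z x.
  by rewrite {1}(divz_eq q m) addrC (lens_d_modq hd).
have e0 : d m q n = d m (q %% m)%Z (n %% m)%Z by apply: lens_d_mod.
have e1 : d m q (n + q) = d m (q %% m)%Z ((n %% m)%Z + (q %% m)%Z).
  rewrite eq1 -[RHS](lens_d_modn hd _ ((n %/ m)%Z + (q %/ m)%Z)) //.
  congr d; rewrite {1}(divz_eq n m) {1}(divz_eq q m); ring.
have nE := divz_eq n m.
rewrite e0 e1; move: (q %% m)%Z (n %% m)%Z (n %/ m)%Z r0 rm mr n0 nm nE
  => r s t r0 rm mr s0 sm nE {e0 e1 eq1}.
have h0 : d m r s + d r m s = reciprocity_rhs m r s.
  by apply: (lens_d_reciprocity hd) => //; lia.
(* Since [s < m], the shifted index [s + r] is still below the reciprocity bound [m + r]. *)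
have h1 : d m r (s + r) + d r m (s + r) = reciprocity_rhs m r (s + r).
  by apply: (lens_d_reciprocity hd) => //; lia.
have h2 : d r m (s + r) = d r m s.
  by rewrite -[in X in s + X](mul1r r) (lens_d_modn hd) // coprimez_sym.
have h3 := reciprocity_rhs_diff s r0 m0.
rewrite 2!(reciprocity_rhsC r) -h0 -h1 h2 in h3.
(* The [- 1] is [- m / m]; the [- 2 * t] comes from [n = t * m + s]. *)
exists (- 1 - 2 * t).
have -> : d m r (s + r) - d m r s = (2 * s%:~R + 1 - m%:~R) / m%:~R.
  by rewrite -h3; ring.
rewrite nE; have : (m%:~R : rat) != 0 by rewrite intr_eq0; lia.
by move=> mn0; field.
Qed.

(** The numerator is the sum of [2 * (n + i * q) + 1] over [i < j]. *)
Lemma lens_d_addMq (n : int) (j : nat) : exists k : int,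
  d m q (n + j%:Z * q) - d m q n
  = (j%:Z * (2 * n + q * (j%:Z - 1) + 1))%:~R / m%:~R + k%:~R.
Proof.
elim: j => [|j [k hk]].
  by exists 0; rewrite mul0r addr0 subrr !mul0r addr0.
have [k' hk'] := lens_d_addq (n + j%:Z * q); exists (k + k').
have -> : n + j.+1%:Z * q = n + j%:Z * q + q by rewrite intS; ring.
have -> : d m q (n + j%:Z * q + q) - d m q n =
   (d m q (n + j%:Z * q + q) - d m q (n + j%:Z * q))
    + (d m q (n + j%:Z * q) - d m q n) by ring.
rewrite hk hk' intS; have : (m%:~R : rat) != 0 by rewrite intr_eq0; lia.
by move: j%:Z {hk hk'} => {}j mn0; field.
Qed.

(** Writing [x = a + j * q] modulo [m], the two factors become [j * q] and
    [2 * a + q * (j - 1) + 1]; their product is [q] times the numerator of the iterated difference,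
    which [m] divides when both terms vanish. *)
Lemma dvdz_lens_d_zeros (a x : int) : d m q a = 0 -> d m q x = 0 ->
  (m %| (x - a) * (x - (q - 1 - a)))%Z.
Proof.
move=> da dx; have m0 : 0 < m by lia.
have [u [v uv]] : exists u v, u * m + v * q = 1.
  by have [u [v e]] := Bezoutz m q; exists u, v; rewrite e; apply/eqP.
(* [v] inverts [q] modulo [m]; reducing modulo [m] makes the number of steps a natural number. *)
pose j := `|((x - a) * v %% m)%Z|%N.
have jE : j%:Z = ((x - a) * v %% m)%Z by rewrite gez0_abs // modz_ge0; lia.
have [t xE] : exists t, x = a + j%:Z * q + t * m.
  exists (((x - a) * v %/ m)%Z * q + (x - a) * u).
  have e := divz_eq ((x - a) * v) m; rewrite -jE in e.
  have -> : a + j%:Z * q + (((x - a) * v %/ m)%Z * q + (x - a) * u) * m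
    = a + ((((x - a) * v %/ m)%Z * m + j%:Z) * q + (x - a) * u * m) by ring.
  rewrite -e.
  have -> : (x - a) * v * q + (x - a) * u * m = (x - a) * (u * m + v * q) by ring.
  by rewrite uv; ring.
have [k hk] := lens_d_addMq a j.
have dj : d m q (a + j%:Z * q) = 0.
  by rewrite -dx [in RHS]xE (lens_d_modn hd).
have mn0 : (m%:~R : rat) != 0 by rewrite intr_eq0; lia.
have e : j%:Z * (2 * a + q * (j%:Z - 1) + 1) = - k * m.
  apply: (@intr_inj rat); rewrite da dj subr0 in hk.
  apply: (mulIf (invr_neq0 mn0)); rewrite [RHS](_ : _ = - k%:~R).
    by move: hk => /eqP; rewrite eq_sym addr_eq0 => /eqP.
  by field.
have -> : (x - a) * (x - (q - 1 - a)) =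
   q * (j%:Z * (2 * a + q * (j%:Z - 1) + 1))
   + t * (2 * a + 2 * j%:Z * q + t * m + 1 - q) * m by rewrite xE; ring.
by rewrite e mulrA -mulrDl dvdz_mull.
Qed.

End Zeros.

Theorem corollary1p8 (d : int -> int -> int -> rat)
  (hd : lens_correction_terms d) (p q : int) (hpq : coprimez p q)
  (hp : p != 0) :
  (#|[set n : 'I_(`|p| ^ 2) | (d (p ^+ 2) q (n : nat)%:Z == 0)%R]| <= `|p|)%N.
Proof.
set S := [set n | _]; have p0 : (0 < `|p|)%N by lia.
have [->|[a aS]] := set_0Vmem S; first by rewrite cards0.
apply: leq_trans (card_split_roots `|p| a%:Z (q - 1 - a%:Z) p0).
have sqE : (`|p| ^ 2)%N%:Z = p ^+ 2 by lia.
apply/subset_leq_card/subsetP => x; rewrite !inE in aS *.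
move: aS => /eqP aS /eqP xS; rewrite sqE.
(* The congruence between zeros was derived for modulus above 1; modulo 1 it is trivial. *)
have [->|m1] := eqVneq (p ^+ 2) 1; first exact: dvd1z.
have {}m1 : 1 < p ^+ 2 by lia.
apply: (@dvdz_lens_d_zeros d) => //.
by rewrite coprimezXl.
Qed.
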